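(* Let $K$ and $L$ be bounded lattices and let $\varphi\colon K\to L$ be a $\{0,1\}$-homomorphism. Define $$\varphi_{\mathrm{Hom}}\colon \mathrm{con}_K(a,b)\mapsto \mathrm{con}_L(\varphi(a),\varphi(b))\qquad\text{for } a\le b \text{ in } K.$$ Then $\varphi_{\mathrm{Hom}}$ is a (well-defined) isotone $\{0,1\}$-map of $\mathrm{Princ}\,K$ into $\mathrm{Princ}\,L$.
   Context: A bounded lattice is a lattice with a least element $0$ and a greatest element $1$. A $\{0,1\}$-homomorphism of bounded lattices is a lattice homomorphism sending $0$ to $0$ and $1$ to $1$. For a lattice $L$ and $a\le b$ in $L$, $\mathrm{con}_L(a,b)$ is the principal congruence generated by $(a,b)$, i.e. the smallest lattice congruence of $L$ collapsing $a$ and $b$. For a bounded lattice $L$, $\mathrm{Princ}\,L$ is the set of all principal congruences of $L$ ordered by inclusion; it is a bounded partially ordered set with least element $\mathrm{con}_L(0,0)$ (the equality relation) and greatest element $\mathrm{con}_L(0,1)$. An isotone map is an order-preserving map; a $\{0,1\}$-map between bounded partially ordered sets is one sending $0$ to $0$ and $1$ to $1$. *)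

(* Defs.v *)
From HB Require Import structures.
From mathcomp Require Import all_boot all_order.
From mathcomp Require Import boolp classical_sets.

Set Implicit Arguments.
Unset Strict Implicit.
Unset Printing Implicit Defensive.
Set Warnings "-redundant-canonical-projection".

Import Order.TTheory.
Local Open Scope order_scope.

Section Congruences.
Context {d : Order.disp_t} {L : latticeType d}.

(* A binary relation on L is encoded as its graph, a set of pairs, so that
   inclusion of congruences is the library's order on sets. *)
Record is_congruence (theta : set (L * L)) : Prop := IsCongruence {
  congruence_refl : forall x, theta (x, x);
  congruence_sym : forall x y, theta (x, y) -> theta (y, x);
  congruence_trans : forall y x z,
    theta (x, y) -> theta (y, z) -> theta (x, z);
  congruence_meet : forall x1 y1 x2 y2,
    theta (x1, y1) -> theta (x2, y2) -> theta (x1 `&` x2, y1 `&` y2);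
  congruence_join : forall x1 y1 x2 y2,
    theta (x1, y1) -> theta (x2, y2) -> theta (x1 `|` x2, y1 `|` y2)
}.

Definition con (a b : L) : set (L * L) :=
  smallest is_congruence [set (a, b)]%classic.

Lemma con_gen (a b : L) : con a b (a, b).
Proof. by move=> theta [_]; apply. Qed.

Lemma con_congruence (a b : L) : is_congruence (con a b).
Proof.
split=> [x|x y xy|y x z xy yz|x1 y1 x2 y2 h1 h2|x1 y1 x2 y2 h1 h2] th thP;
  have [cong_th _] := thP.
- exact: congruence_refl.
- by apply: congruence_sym => //; apply: xy.
- by apply: (congruence_trans cong_th (xy _ thP) (yz _ thP)).
- by apply: congruence_meet => //; [apply: h1|apply: h2].
- by apply: congruence_join => //; [apply: h1|apply: h2].
Qed.

Lemma con_min (a b : L) (theta : set (L * L)) :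
  is_congruence theta -> theta (a, b) -> (con a b `<=` theta)%classic.
Proof. by move=> cth ab; apply: smallest_sub => // _ ->. Qed.

Definition principal_congruences : set (set (L * L)) :=
  [set theta | exists a b : L, a <= b /\ theta = con a b]%classic.

End Congruences.

Section Princ.
Context {d : Order.disp_t}.

Record Princ (L : tbLatticeType d) : Type := MkPrinc {
  Princ_val : set (L * L);
  _ : Princ_val \in principal_congruences
}.

Variable L : tbLatticeType d.

HB.instance Definition _ := [isSub for @Princ_val L].
HB.instance Definition _ := [Choice of Princ L by <:].
HB.instance Definition _ :=
  [SubChoice_isSubPOrder of Princ L by <: with set_display].

Lemma con_principal (a b : L) :
  a <= b -> con a b \in @principal_congruences d L.
Proof. by move=> ab; rewrite inE; exists a, b. Qed.

Definition princ (a b : L) (ab : a <= b) : Princ L :=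
  MkPrinc (con_principal ab).

Lemma Princ_leP (x y : Princ L) :
  reflect (val x `<=` val y)%classic (x <= y).
Proof. exact: asboolP. Qed.

Lemma Princ_le0 (x : Princ L) : princ (lexx (\bot : L)) <= x.
Proof.
have [a [b [_ xE]]] : principal_congruences (val x) by apply/set_mem/valP.
apply/Princ_leP; rewrite xE; apply: con_min; first exact: con_congruence.
exact: congruence_refl (con_congruence a b) _.
Qed.

Lemma Princ_le1 (x : Princ L) : x <= princ (le0x (\top : L)).
Proof.
have [a [b [_ xE]]] : principal_congruences (val x) by apply/set_mem/valP.
apply/Princ_leP; rewrite xE; apply: con_min; first exact: con_congruence.
have c01 := con_congruence (\bot : L) \top.
have eq0 z : con \bot \top (z, \bot : L).
  have := congruence_meet c01 (congruence_refl c01 z) (@con_gen _ L \bot \top).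
  by rewrite meetx0 meetx1 => /(congruence_sym c01).
exact: (congruence_trans c01 (eq0 a) (congruence_sym c01 (eq0 b))).
Qed.

(* Hence \bot is con(0,0), the equality relation, and \top is con(0,1). *)
HB.instance Definition _ :=
  Order.hasBottom.Build set_display (Princ L) Princ_le0.
HB.instance Definition _ :=
  Order.hasTop.Build set_display (Princ L) Princ_le1.

End Princ.

(* Well-definedness of con(a,b) |-> con(phi a, phi b) is the existence of a
   function f with this property; it is unique because the [princ ab] exhaust
   [Princ K]. *)
Definition is_princ_hom (d d' : Order.disp_t)
    (K : tbLatticeType d) (L : tbLatticeType d') (phi : {lmorphism K -> L})
    (f : Princ K -> Princ L) : Prop :=
  forall (a b : K) (ab : a <= b), f (princ ab) = princ (omorph_le phi ab).

(* Main.v *)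
(* The preimage under [phi] of a congruence of [L] is a congruence of [K];
   applied to con(phi c, phi d), this shows that con(a,b) <= con(c,d) implies
   con(phi a, phi b) <= con(phi c, phi d), which gives at once that the map is
   well defined and isotone. *)
Require Import Defs.
From HB Require Import structures.
From mathcomp Require Import all_boot all_order.
From mathcomp Require Import boolp classical_sets.

Import Order.TTheory.
Local Open Scope order_scope.

Lemma is_congruence_preimage (d d' : Order.disp_t)
    (K : latticeType d) (L : latticeType d') (phi : {lmorphism K -> L})
    (theta : set (L * L)) :
  is_congruence theta ->
  is_congruence [set p : K * K | theta (phi p.1, phi p.2)]%classic.
Proof.
move=> cth; split=> [x|x y|y x z|x1 y1 x2 y2|x1 y1 x2 y2] /=.
- exact: congruence_refl.
- exact: congruence_sym.
- exact: congruence_trans.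
- by rewrite !omorphI; apply: congruence_meet.
- by rewrite !omorphU; apply: congruence_join.
Qed.

Lemma con_lmorphism_subset (d d' : Order.disp_t)
    (K : latticeType d) (L : latticeType d') (phi : {lmorphism K -> L})
    (a b c e : K) :
  (con a b `<=` con c e -> con (phi a) (phi b) `<=` con (phi c) (phi e))%classic.
Proof.
move=> sub; apply: con_min; first exact: con_congruence.
(* The pair [(a, b)] lies in [con a b], hence by [sub] in [con c e], so it remains to bound the
   latter by the preimage congruence. *)
have ce : (con c e `<=`
    [set p : K * K | con (phi c) (phi e) (phi p.1, phi p.2)])%classic.
  apply: con_min; last exact: con_gen.
  exact/is_congruence_preimage/con_congruence.
exact: ce (sub _ (@con_gen _ K a b)).
Qed.

Lemma princ_lmorphism_le (d d' : Order.disp_t)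
    (K : tbLatticeType d) (L : tbLatticeType d') (phi : {lmorphism K -> L})
    (a b c e : K) (ab : a <= b) (ce : c <= e) :
  princ ab <= princ ce ->
  princ (omorph_le phi ab) <= princ (omorph_le phi ce).
Proof. by move=> /Princ_leP sub; apply/Princ_leP; apply: con_lmorphism_subset. Qed.

Lemma princ_surj {d : Order.disp_t} {K : tbLatticeType d} (x : Princ K) :
  exists (a b : K) (ab : a <= b), x = princ ab.
Proof.
have [a [b [ab xE]]] : principal_congruences (val x) by apply/set_mem/valP.
by exists a, b, ab; apply: val_inj.
Qed.

Theorem lemma3 (d d' : Order.disp_t)
    (K : tbLatticeType d) (L : tbLatticeType d') (phi : {lmorphism K -> L})
    (phi0 : phi \bot = \bot) (phi1 : phi \top = \top) :
  exists phiHom : Princ K -> Princ L,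
    [/\ unique (is_princ_hom phi) phiHom,
        {homo phiHom : x y / x <= y},
        phiHom \bot = \bot
      & phiHom \top = \top].
Proof.
(* Asking that [y] fit every representation of [x] as a [princ ab] puts well-definedness into this
   existence claim, so any choice function will do. *)
have /choice[f fP] (x : Princ K) : exists y : Princ L,
    forall (a b : K) (ab : a <= b),
      x = princ ab -> y = princ (omorph_le phi ab).
  have [a [b [ab ->]]] := princ_surj x.
  exists (princ (omorph_le phi ab)) => c e ce abce.
  (* Equal principal congruences lie below each other, so their images do too. *)
  by apply: le_anti; rewrite !princ_lmorphism_le ?abce.
have fE : is_princ_hom phi f by move=> a b ab; apply: fP.
exists f; split.
- split=> // g gE; apply/funext => x.
  by have [a [b [ab ->]]] := princ_surj x; rewrite fE gE.
- move=> x y; have [a [b [ab ->]]] := princ_surj x.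
  have [c [e [ce ->]]] := princ_surj y.
  by rewrite !fE; apply: princ_lmorphism_le.
(* [\bot] unfolds to [princ (lexx \bot)] and [\top] to [princ (le0x \top)], so [fE] applies;
   [val_inj] reduces to the underlying relations. As [\top] is generated by both bounds, its case
   needs [phi0] as well as [phi1]. *)
- by rewrite [LHS]fE; apply: val_inj; rewrite /= phi0.
- by rewrite [LHS]fE; apply: val_inj; rewrite /= phi0 phi1.
Qed.
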